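(* Let $m\ge 5$ and let $\mathbb{S}^m$ be the Euclidean unit sphere. For any $\varepsilon>0$ there exists a smooth map $\phi:\mathbb{S}^m\to\mathbb{S}^m$, homotopic to the identity map $\operatorname{Id}:\mathbb{S}^m\to\mathbb{S}^m$, with $E_2^c(\phi)<\varepsilon$.
   Context: For a smooth map $\phi:(M^m,g)\to(N^n,h)$ between Riemannian manifolds with $M$ compact, the conformal-bienergy functional is $$E_2^c(\phi)=\frac12\int_M\Big(|\tau(\phi)|^2+\frac23\operatorname{Scal}|d\phi|^2-2\operatorname{Tr}\langle d\phi(\operatorname{Ric}(\cdot)),d\phi(\cdot)\rangle\Big)\,v_g ,$$ where $\tau(\phi)=\operatorname{Tr}\nabla^\phi d\phi$ is the tension field, $\nabla^\phi$ is the pull-back connection on $\phi^{-1}TN$ (together with the Levi-Civita connection of $M$), traces are with respect to $g$, $\operatorname{Ric}$ is the $(1,1)$ Ricci tensor of $M$ and $\operatorname{Scal}=\operatorname{Tr}\operatorname{Ric}$ its scalar curvature (positive on round spheres). *)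

(* Defs.v *)
From HB Require Import structures.
From mathcomp Require Import all_boot all_order all_algebra.
From mathcomp Require Import all_classical all_reals all_analysis.
Set Implicit Arguments.
Unset Strict Implicit.
Unset Printing Implicit Defensive.
Import Order.TTheory GRing.Theory Num.Theory.
Import numFieldNormedType.Exports.
Local Open Scope classical_set_scope.
Local Open Scope ring_scope.

(* The library norm on 'rV[R]_n is the sup norm, so the Euclidean inner product
   and norm are introduced here. *)
Definition dotp (R : realType) n (u v : 'rV[R]_n) : R := (u *m v^T) 0 0.

Definition enorm (R : realType) n (u : 'rV[R]_n) : R := Num.sqrt (dotp u u).

Definition sphere (R : realType) m : set 'rV[R]_m.+1 :=
  [set x | enorm x = 1].
Arguments sphere : clear implicits.

Fixpoint iter_derive (R : realType) (V W : normedModType R)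
    (vs : seq V) (f : V -> W) : V -> W :=
  if vs is v :: vs' then (fun x => 'D_v (iter_derive vs' f) x) else f.

(* C^oo on U: all iterated directional derivatives exist and are continuous. *)
Definition smooth_on (R : realType) (V W : normedModType R)
    (U : set V) (f : V -> W) : Prop :=
  forall (vs : seq V) (v x : V), U x ->
    derivable (iter_derive vs f) x v /\ {for x, continuous (iter_derive vs f)}.

(* A map on a subset A of a normed space is smooth when it extends to a smooth
   map near every point of A; the values of f outside A are irrelevant. *)
Definition smooth_map (R : realType) (V W : normedModType R)
    (A : set V) (f : V -> W) : Prop :=
  forall x, A x -> exists (U : set V) (F : V -> W),
    [/\ open U, U x, smooth_on U F & forall y, U y -> A y -> f y = F y].

Definition homotopic (R : realType) (V W : topologicalType)
    (A : set V) (B : set W) (f g : V -> W) : Prop :=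
  exists H : V * R -> W,
    [/\ {within A `*` `[0, 1], continuous H},
        set_fun (A `*` `[0, 1]) B H,
        (forall x, A x -> H (x, 0) = f x) &
        (forall x, A x -> H (x, 1) = g x)].

Section SphereGeometry.
Context {R : realType}.

(* Orthogonal projection onto the tangent space x^\perp, for x on the sphere. *)
Definition proj m (x v : 'rV[R]_m.+1) : 'rV[R]_m.+1 := v - dotp v x *: x.

Definition retract m (y : 'rV[R]_m.+1) : 'rV[R]_m.+1 := (enorm y)^-1 *: y.

(* Derivative at x in S^m, in the tangent direction v, of a vector-valued map f
   on S^m: the derivative at t = 0 of f along the curve (x + t v) / |x + t v|
   of S^m.  Only the values of f on S^m matter. *)
Definition dtan m n (f : 'rV[R]_m.+1 -> 'rV[R]_n) (x v : 'rV[R]_m.+1) :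
    'rV[R]_n :=
  'D_v (f \o @retract m) x.

(* Vector fields are functions on R^(m+1), of which only the restriction to S^m
   is used.  The Levi-Civita connection of the metric induced by R^(m+1) is the
   tangential part of the Euclidean derivative. *)
Definition nabla m (X Y : 'rV[R]_m.+1 -> 'rV[R]_m.+1) :
    'rV[R]_m.+1 -> 'rV[R]_m.+1 :=
  fun x => proj x (dtan Y x (X x)).

Definition bracket m (X Y : 'rV[R]_m.+1 -> 'rV[R]_m.+1) :
    'rV[R]_m.+1 -> 'rV[R]_m.+1 :=
  fun x => dtan Y x (X x) - dtan X x (Y x).

Definition curvature m (X Y Z : 'rV[R]_m.+1 -> 'rV[R]_m.+1) :
    'rV[R]_m.+1 -> 'rV[R]_m.+1 :=
  fun x => nabla X (nabla Y Z) x - nabla Y (nabla X Z) x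
           - nabla (bracket X Y) Z x.

(* Tensors are evaluated at tangent vectors by extending these to tangent
   fields; the result does not depend on the extension. *)
Definition ext m (v : 'rV[R]_m.+1) : 'rV[R]_m.+1 -> 'rV[R]_m.+1 :=
  fun y => proj y v.

(* The rows of E form an orthonormal basis of the tangent space at x. *)
Definition orthonormal_frame m (x : 'rV[R]_m.+1) (E : 'M[R]_(m, m.+1)) : Prop :=
  E *m E^T = 1%:M /\ E *m x^T = 0.

(* Some orthonormal basis of the tangent space at x, used to write traces with
   respect to the metric. *)
Definition frame m (x : 'rV[R]_m.+1) (i : 'I_m) : 'rV[R]_m.+1 :=
  row i (xget 0 [set E | orthonormal_frame x E]).

Definition Ric m (x v : 'rV[R]_m.+1) : 'rV[R]_m.+1 :=
  \sum_(i < m) curvature (ext v) (ext (frame x i)) (ext (frame x i)) x.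

Definition Scal m (x : 'rV[R]_m.+1) : R :=
  \sum_(i < m) dotp (Ric x (frame x i)) (frame x i).

(* Pull-back connection on phi^-1 TS^n; V is a vector field along phi, that is,
   V x is tangent to S^n at phi x. *)
Definition pullback_nabla m n (phi : 'rV[R]_m.+1 -> 'rV[R]_n.+1)
    (X : 'rV[R]_m.+1 -> 'rV[R]_m.+1) (V : 'rV[R]_m.+1 -> 'rV[R]_n.+1) :
    'rV[R]_m.+1 -> 'rV[R]_n.+1 :=
  fun x => proj (phi x) (dtan V x (X x)).

Definition nabla_d m n (phi : 'rV[R]_m.+1 -> 'rV[R]_n.+1)
    (X Y : 'rV[R]_m.+1 -> 'rV[R]_m.+1) : 'rV[R]_m.+1 -> 'rV[R]_n.+1 :=
  fun x => pullback_nabla phi X (fun y => dtan phi y (Y y)) x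
           - dtan phi x (nabla X Y x).

Definition tension m n (phi : 'rV[R]_m.+1 -> 'rV[R]_n.+1)
    (x : 'rV[R]_m.+1) : 'rV[R]_n.+1 :=
  \sum_(i < m) nabla_d phi (ext (frame x i)) (ext (frame x i)) x.

Definition normsq_d m n (phi : 'rV[R]_m.+1 -> 'rV[R]_n.+1)
    (x : 'rV[R]_m.+1) : R :=
  \sum_(i < m) dotp (dtan phi x (frame x i)) (dtan phi x (frame x i)).

Definition ric_term m n (phi : 'rV[R]_m.+1 -> 'rV[R]_n.+1)
    (x : 'rV[R]_m.+1) : R :=
  \sum_(i < m) dotp (dtan phi x (Ric x (frame x i))) (dtan phi x (frame x i)).

End SphereGeometry.

(* Lebesgue measure on R^n, realised as n-tuples of reals: the product measure
   on R * R^n is transported to R^(n+1). *)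
Section LebesgueTuple.
Context {R : realType}.
Local Notation T := (measurableTypeR R).

Definition cons_pair n (p : T * n.-tuple T) : n.+1.-tuple T :=
  [tuple of p.1 :: p.2].

Lemma measurable_cons_pair n : measurable_fun setT (@cons_pair n).
Proof. exact: measurable_cons. Qed.

Section Step.
Variables (n : nat) (mu : {sigma_finite_measure set (n.-tuple T) -> \bar R}).

Definition lebesgue_tuple_step : set (n.+1.-tuple T) -> \bar R :=
  pushforward (@lebesgue_measure R \x mu)%E (@cons_pair n).

Let step_measurable (A : set (n.+1.-tuple T)) :
  measurable A -> measurable (@cons_pair n @^-1` A).
Proof.
by move=> mA; rewrite -[X in measurable X]setTI; exact: measurable_cons_pair.
Qed.

Let step0 : lebesgue_tuple_step set0 = 0%E.
Proof. by rewrite /lebesgue_tuple_step /pushforward preimage_set0 measure0. Qed.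

Let step_ge0 A : (0 <= lebesgue_tuple_step A)%E.
Proof. by rewrite /lebesgue_tuple_step /pushforward; apply: measure_ge0. Qed.

Let step_sigma_additive : semi_sigma_additive lebesgue_tuple_step.
Proof.
move=> F mF tF mUF.
rewrite /lebesgue_tuple_step /pushforward preimage_bigcup.
apply: measure_semi_sigma_additive.
- by move=> k; exact: step_measurable.
- apply/trivIsetP => /= i j _ _ ij; rewrite -preimage_setI.
  by move/trivIsetP : tF => /(_ _ _ _ _ ij) ->//; rewrite preimage_set0.
- by rewrite -preimage_bigcup; exact: step_measurable.
Qed.

HB.instance Definition _ := isMeasure.Build _ _ _
  lebesgue_tuple_step step0 step_ge0 step_sigma_additive.

Let step_sigma_finite : sigma_finite setT lebesgue_tuple_step.
Proof.
have /sigma_finiteP[F [TF ndF Foo]] := sigma_finiteT (@lebesgue_measure R).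
have /sigma_finiteP[G [TG ndG Goo]] := sigma_finiteT mu.
pose g (t : n.+1.-tuple T) : T * n.-tuple T := (thead t, [tuple of behead t]).
have mg : measurable_fun setT g.
  by apply/measurable_fun_pairP; split;
    [exact: measurable_tnth|exact: measurable_behead].
have gK p : g (cons_pair p) = p.
  by case: p => x t; congr pair; apply: val_inj.
exists (fun k => g @^-1` (F k `*` G k)).
  apply/seteqP; split => // t _.
  have [k _ Fk] : (\bigcup_k F k) (thead t) by rewrite -TF.
  have [l _ Gl] : (\bigcup_k G k) [tuple of behead t] by rewrite -TG.
  exists (maxn k l) => //; split => /=.
  - by move: Fk; exact/subsetPset/ndF/leq_maxl.
  - by move: Gl; exact/subsetPset/ndG/leq_maxr.
move=> k; have [? ?] := Foo k; have [? ?] := Goo k; split.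
  by rewrite -[X in measurable X]setTI; apply: mg => //; exact: measurableX.
rewrite /lebesgue_tuple_step /pushforward -comp_preimage.
rewrite (_ : g \o _ = id); last by apply/funext => p; exact: gK.
by rewrite preimage_id product_measure1E// lte_mul_pinfty// ge0_fin_numE.
Qed.

HB.instance Definition _ := Measure_isSigmaFinite.Build _ _ _
  lebesgue_tuple_step step_sigma_finite.

End Step.

Fixpoint lebesgue_tuple n : {sigma_finite_measure set (n.-tuple T) -> \bar R} :=
  match n with
  | 0 => \d_([tuple] : 0.-tuple T)
  | n'.+1 => lebesgue_tuple_step (lebesgue_tuple n')
  end.

End LebesgueTuple.
Arguments lebesgue_tuple : clear implicits.

Section SphereIntegral.
Context {R : realType}.

(* Inverse stereographic projection R^m -> S^m; its image is S^m minus the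
   point (1, 0, ..., 0). *)
Definition stereo m (u : 'rV[R]_m) : 'rV[R]_m.+1 :=
  (dotp u u + 1)^-1 *: (row_mx ((dotp u u - 1)%:M : 'rV_1) (2 *: u) :
                        'rV_(1 + m)).

(* Volume density sqrt (det g_ij) of the round metric in the chart [stereo]:
   the rows of the Jacobian matrix are the coordinate vector fields. *)
Definition vol_density m (u : 'rV[R]_m) : R :=
  Num.sqrt (\det (jacobian (@stereo m) u *m (jacobian (@stereo m) u)^T)).

(* Integral over S^m with respect to the Riemannian volume v_g, computed in the
   chart [stereo], which misses a single point, hence a v_g-null set. *)
Definition sphere_integral m (f : 'rV[R]_m.+1 -> R) : \bar R :=
  (\int[lebesgue_tuple R m]_t
     (let u := \row_i tnth t i in f (stereo u) * vol_density u)%:E)%E.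

(* For smooth phi the integrand is continuous on S^m, so that the extended real
   below is finite. *)
Definition E2c m n (phi : 'rV[R]_m.+1 -> 'rV[R]_n.+1) : \bar R :=
  ((2^-1)%:E * sphere_integral (fun x =>
     dotp (tension phi x) (tension phi x)
     + 2 / 3 * Scal x * normsq_d phi x
     - 2 * ric_term phi x)%R)%E.

End SphereIntegral.

(* Main.v *)
(** The map is a conformal dilation [phi_l] of the sphere, [u |-> l u] in the
    stereographic chart, with [l] large. A conformal map of the round sphere
    with factor [c] has [|d phi|^2 = m c^2] and
    [|tau|^2 = (m-2)^2 c^2 |grad ln c|^2], and the curvature terms of the
    energy combine to [(2/3)(m-1)(m-3) |d phi|^2]. In the chart, with
    [q = |u|^2], the energy density of [phi_l] is at most a constant times
    [l^4 (1 + l^2 q)^-3 (1 + q)^(5-m)]. Spreading the exponent 3 as 3/5 over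
    five of the coordinates, and bounding the rest coordinatewise too, gives a
    product of functions of one variable that are integrable because 6/5 > 1.
    By scaling each of the five contributes a factor [O(1/l)], so the energy is
    [O(l^4 / l^5)]. *)
Require Import Defs.
From mathcomp Require Import all_boot all_order all_algebra.
From mathcomp Require Import all_classical all_reals all_analysis.
From mathcomp Require Import measurable_realfun ring lra.
Set Implicit Arguments.
Unset Strict Implicit.
Unset Printing Implicit Defensive.
Import Order.TTheory GRing.Theory Num.Theory.
Import numFieldNormedType.Exports.
Local Open Scope classical_set_scope.
Local Open Scope ring_scope.
Local Notation proj := Defs.proj.

(** * Algebra of the Euclidean inner product *)

Section Dotp.
Context {R : realType} {n : nat}.
Implicit Types (u v w : 'rV[R]_n) (k : R).

Lemma dotpE u v : dotp u v = \sum_i u 0 i * v 0 i.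
Proof. by rewrite /dotp mxE; apply: eq_bigr => i _; rewrite mxE. Qed.

Lemma dotpC u v : dotp u v = dotp v u.
Proof. by rewrite !dotpE; apply: eq_bigr => i _; rewrite mulrC. Qed.

Lemma dotpDl u v w : dotp (u + v) w = dotp u w + dotp v w.
Proof. by rewrite /dotp mulmxDl mxE. Qed.

Lemma dotpZl k u v : dotp (k *: u) v = k * dotp u v.
Proof. by rewrite /dotp -scalemxAl mxE. Qed.

Lemma dotpNl u v : dotp (- u) v = - dotp u v.
Proof. by rewrite -scaleN1r dotpZl mulN1r. Qed.

Lemma dotpDr u v w : dotp w (u + v) = dotp w u + dotp w v.
Proof. by rewrite dotpC dotpDl !(dotpC w). Qed.

Lemma dotpZr k u v : dotp v (k *: u) = k * dotp v u.
Proof. by rewrite dotpC dotpZl dotpC. Qed.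

Lemma dotpNr u v : dotp v (- u) = - dotp v u.
Proof. by rewrite dotpC dotpNl dotpC. Qed.

Lemma dot0p u : dotp 0 u = 0.
Proof. by rewrite -(scale0r u) dotpZl mul0r. Qed.

Lemma dotp0 u : dotp u 0 = 0.
Proof. by rewrite dotpC dot0p. Qed.

Lemma dotp_ge0 u : 0 <= dotp u u.
Proof. by rewrite dotpE sumr_ge0// => i _; rewrite -expr2 sqr_ge0. Qed.

Lemma dotp_eq0 u : (dotp u u == 0) = (u == 0).
Proof.
apply/idP/eqP => [|->]; last by rewrite dotp0.
rewrite dotpE psumr_eq0 => [/allP u0|i _]; last by rewrite -expr2 sqr_ge0.
by apply/rowP => i; have := u0 i (mem_index_enum _);
  rewrite /= mulf_eq0 orbb mxE => /eqP.
Qed.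

Lemma dotp_delta u j : dotp u (delta_mx 0 j) = u 0 j.
Proof.
rewrite dotpE (bigD1 j)//= mxE !eqxx mulr1 big1 ?addr0// => i ij.
by rewrite mxE (negbTE ij) andbF mulr0.
Qed.

Lemma dotp_row p (A : 'M[R]_(p, n)) (B : 'M[R]_(p, n)) i j :
  dotp (row i A) (row j B) = (A *m B^T) i j.
Proof. by rewrite dotpE mxE; apply: eq_bigr => k _; rewrite !mxE. Qed.

End Dotp.

Definition dotpD := (@dotpDl, @dotpDr).
Definition dotpN := (@dotpNl, @dotpNr).
Definition dotpZ := (@dotpZl, @dotpZr).

(** * Product, chain and quotient rules for directional derivatives *)

Section DerivationRules.
Context {R : realType} {V : normedModType R}.
Implicit Types (x v : V).

Lemma is_derive_mxP m n (M : V -> 'M[R]_(m, n)) x v (dM : 'M[R]_(m, n)) :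
  is_derive x v M dM <->
  forall i j, is_derive x v (fun y => M y i j) (dM i j).
Proof.
split=> [[dMx <-] i j|dMx].
  apply: DeriveDef; first by move/derivable_mxP : dMx; apply.
  by rewrite derive_mx// mxE.
have ? : derivable M x v by apply/derivable_mxP => i j; exact: ex_derive.
apply: DeriveDef => //; rewrite derive_mx//; apply/matrixP => i j.
by rewrite mxE derive_val.
Qed.

Lemma is_derive_scalemx m n (s : V -> R) (M : V -> 'M[R]_(m, n)) x v ds dM :
  is_derive x v s ds -> is_derive x v M dM ->
  is_derive x v (fun y => s y *: M y) (ds *: M x + s x *: dM).
Proof.
move=> dsx /is_derive_mxP dMx; apply/is_derive_mxP => i j.
rewrite (_ : (fun y => _) = s * (fun y => M y i j)); last first.
  by apply/funext => y; rewrite mxE.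
have := is_deriveM dsx (dMx i j).
by move=> /is_derive_eq; apply; rewrite !mxE addrC [ds * _]mulrC.
Qed.

Lemma is_derive_dotp n (f g : V -> 'rV[R]_n) x v df dg :
  is_derive x v f df -> is_derive x v g dg ->
  is_derive x v (fun y => dotp (f y) (g y)) (dotp df (g x) + dotp (f x) dg).
Proof.
move=> /is_derive_mxP dfx /is_derive_mxP dgx.
rewrite (_ : (fun y => _) = \sum_i ((fun y => f y 0 i) * (fun y => g y 0 i)));
  last by apply/funext => y; rewrite dotpE fct_sumE.
have := is_derive_sum (fun i => is_deriveM (dfx 0 i) (dgx 0 i)).
move=> /is_derive_eq; apply; rewrite !dotpE -big_split/=; apply: eq_bigr => i _.
by rewrite addrC [df 0 i * _]mulrC.
Qed.

(** A directional derivative is an ordinary derivative at 0 along [h |-> h *: v + x], so the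
    one-variable chain rule suffices and [f] need only be derivable in the direction [v]. *)
Lemma is_derive_comp1 (f : V -> R) (g : R -> R) x v df dg :
  is_derive x v f df -> is_derive (f x) 1 g dg ->
  is_derive x v (g \o f) (dg * df).
Proof.
pose line (h : R) := h *: v + x.
have D (k : V -> R) : 'D_v k x = 'D_1 (k \o line) 0.
  rewrite /derive; set g1 := fun h => h^-1 *: _; set g2 := fun h => h^-1 *: _.
  suff -> : g1 = g2 by [].
  rewrite funeqE /g1 /g2 => h /=.
  by rewrite /line /= addr0 scale0r add0r [_%:A]mulr1.
move=> [fx fE] gx.
have l0 : line 0 = x by rewrite /line scale0r add0r.
have fl : is_derive (0 : R) 1 (f \o line) df.
  by apply: DeriveDef; [exact: (derivable1P f x v).1|rewrite -D].
have gl : is_derive ((f \o line) 0) 1 g dg by rewrite /= l0.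
have gfl := @is_derive1_comp _ g (f \o line) 0 dg df gl fl.
apply: DeriveDef.
  by apply/(derivable1P (g \o f)); exact: (@ex_derive _ _ _ _ _ _ _ gfl).
by rewrite D; exact: (@derive_val _ _ _ _ _ _ _ gfl).
Qed.

Lemma is_deriveV (f : V -> R) x v df : f x != 0 ->
  is_derive x v f df -> is_derive x v (fun y => (f y)^-1) (- (f x) ^- 2 * df).
Proof.
move=> fx0 [dfx <-]; apply: DeriveDef; first exact: derivableV.
by rewrite deriveV.
Qed.

End DerivationRules.

Lemma is_derive_mulmxr (R : realType) n p (E : 'M[R]_(n, p)) (x v : 'rV[R]_n) :
  is_derive x v (fun y => y *m E) (v *m E).
Proof.
have rE (y : 'rV[R]_n) i j : (y *m E) i j = dotp y (col j E)^T.
  by rewrite dotpE mxE ord1; apply: eq_bigr => k _; rewrite !mxE.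
apply/is_derive_mxP => i j; rewrite rE.
rewrite (_ : (fun y => _) = fun y => dotp y (col j E)^T); last first.
  by apply/funext => y; exact: rE.
have := is_derive_dotp (is_derive_id x v) (is_derive_cst (col j E)^T x v).
by move=> /is_derive_eq; apply; rewrite dotp0 addr0.
Qed.

(** * Differentiability of vector-valued expressions *)

Section Differentiability.
Context {R : realType}.

Lemma differentiable_rV (V : normedModType R) n (f : V -> 'rV[R]_n) x :
  (forall j, differentiable (fun y => f y 0 j) x) -> differentiable f x.
Proof.
move=> df; rewrite (_ : f = \sum_j (fun y => f y 0 j *: delta_mx 0 j)).
  by apply: differentiable_sum => j; exact: differentiableZl.
by apply/funext => y; rewrite fct_sumE -row_sum_delta.
Qed.

Lemma differentiable_scale (V : normedModType R) n (s : V -> R)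
    (f : V -> 'rV[R]_n) x : differentiable s x -> differentiable f x ->
  differentiable (fun y => s y *: f y) x.
Proof.
move=> ds df; apply: differentiable_rV => j.
rewrite (_ : (fun y => _) = s * (fun y => f y 0 j)); last first.
  by apply/funext => y; rewrite mxE.
apply: differentiableM => //.
exact: (differentiable_comp df (differentiable_coord _ _ _)).
Qed.

Lemma differentiable_dotp (V : normedModType R) n (f g : V -> 'rV[R]_n) x :
  differentiable f x -> differentiable g x ->
  differentiable (fun y => dotp (f y) (g y)) x.
Proof.
move=> df dg.
rewrite (_ : (fun y => _) = \sum_i ((fun y => f y 0 i) * (fun y => g y 0 i)));
  last by apply/funext => y; rewrite dotpE fct_sumE.
apply: differentiable_sum => i; apply: differentiableM.
  exact: (differentiable_comp df (differentiable_coord _ _ _)).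
exact: (differentiable_comp dg (differentiable_coord _ _ _)).
Qed.

Lemma differentiable_mulmxr n p (E : 'M[R]_(n, p)) (x : 'rV[R]_n) :
  differentiable (fun y => y *m E) x.
Proof.
apply: differentiable_rV => j.
rewrite (_ : (fun y => _) = \sum_k (fun y : 'rV[R]_n => y 0 k * E k j)).
  apply: differentiable_sum => k; apply: differentiableM => //.
  exact: differentiable_coord.
by apply/funext => y; rewrite mxE fct_sumE.
Qed.

End Differentiability.

(** * Tangential calculus and curvature of the sphere *)

Section SphereCalculus.
Context {R : realType} {m : nat}.
Implicit Types (x y u v w e : 'rV[R]_m.+1).

Lemma sphereP x : sphere R m x <-> dotp x x = 1.
Proof.
rewrite /sphere /= /enorm; split=> [xx|->]; last by rewrite sqrtr1.
by rewrite -(sqr_sqrtr (dotp_ge0 x)) xx expr1n.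
Qed.

Lemma retract_id x : sphere R m x -> retract x = x.
Proof. by rewrite /sphere /retract /= => ->; rewrite invr1 scale1r. Qed.

Lemma retract_sphere x : x != 0 -> sphere R m (retract x).
Proof.
move=> x0; apply/sphereP; rewrite /retract dotpZl dotpZr mulrA -expr2 exprVn.
by rewrite sqr_sqrtr ?dotp_ge0// mulVf// dotp_eq0.
Qed.

Lemma sphere_neq0 x : sphere R m x -> x != 0.
Proof. by move=> /sphereP x1; rewrite -dotp_eq0 x1 oner_eq0. Qed.

Lemma proj_tangent x v : dotp v x = 0 -> proj x v = v.
Proof. by rewrite /proj => ->; rewrite scale0r subr0. Qed.

Lemma dotp_projl x v : sphere R m x -> dotp (proj x v) x = 0.
Proof.
by move=> /sphereP x1; rewrite /proj !dotpD !dotpN !dotpZ x1 mulr1 subrr.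
Qed.

(** The derivative of [|y|^-1] at a unit vector [x] is [- <v, x>], which removes exactly the radial
    part of [v]. *)
Lemma is_derive_retract x v : sphere R m x ->
  is_derive x v (@retract R m) (proj x v).
Proof.
move=> /[dup] xS /sphereP x1.
have d1 : is_derive x v (fun y => dotp y y) (dotp v x + dotp x v).
  by apply: is_derive_dotp; exact: is_derive_id.
have d2 : is_derive (dotp x x) 1 (@Num.sqrt R) (2 * Num.sqrt (dotp x x))^-1.
  by apply: is_derive1_sqrt; rewrite x1.
have d3 := is_deriveV (f := (@Num.sqrt R \o fun y => dotp y y)) _
  (is_derive_comp1 d1 d2).
have {}d3 := d3 (ltac:(by rewrite /= x1 sqrtr1 oner_neq0)).
have d4 := is_derive_scalemx d3 (is_derive_id x v).
apply: (is_derive_eq d4) => /=; rewrite x1 sqrtr1 (dotpC x v) /proj.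
rewrite !(expr1n, invr1, mulr1, scale1r) addrC; congr (_ + _).
by rewrite -scaleNr; congr (_ *: _); field.
Qed.

Section Tangential.
Variables (x v : 'rV[R]_m.+1).
Hypothesis xS : sphere R m x.
Local Notation is_dtan f df := (is_derive x v (f \o @retract R m) df).

Lemma dtanE n (f : 'rV[R]_m.+1 -> 'rV[R]_n) df : is_dtan f df ->
  dtan f x v = df.
Proof. by move=> fdf; exact: (@derive_val _ _ _ _ _ _ _ fdf). Qed.

Lemma is_dtan_cst (W : normedModType R) (k : W) : is_dtan (fun _ => k) 0.
Proof. exact: is_derive_cst. Qed.

Lemma is_dtan_id : is_dtan (fun y => y) (proj x v).
Proof. exact: is_derive_retract. Qed.

Lemma is_dtanD (W : normedModType R) (f g : 'rV[R]_m.+1 -> W) df dg :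
  is_dtan f df -> is_dtan g dg -> is_dtan (fun y => f y + g y) (df + dg).
Proof. exact: is_deriveD. Qed.

Lemma is_dtanB (W : normedModType R) (f g : 'rV[R]_m.+1 -> W) df dg :
  is_dtan f df -> is_dtan g dg -> is_dtan (fun y => f y - g y) (df - dg).
Proof. exact: is_deriveB. Qed.

Lemma is_dtanN (W : normedModType R) (f : 'rV[R]_m.+1 -> W) df :
  is_dtan f df -> is_dtan (fun y => - f y) (- df).
Proof. exact: is_deriveN. Qed.

Lemma is_dtanM (s t : 'rV[R]_m.+1 -> R) ds dt :
  is_dtan s ds -> is_dtan t dt ->
  is_dtan (fun y => s y * t y) (ds * t x + s x * dt).
Proof.
move=> sd td; have := is_deriveM sd td.
by move=> /is_derive_eq; apply; rewrite /= retract_id// addrC (mulrC ds).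
Qed.

Lemma is_dtanZ n (s : 'rV[R]_m.+1 -> R) (f : 'rV[R]_m.+1 -> 'rV[R]_n) ds df :
  is_dtan s ds -> is_dtan f df ->
  is_dtan (fun y => s y *: f y) (ds *: f x + s x *: df).
Proof.
move=> sd fd; have := is_derive_scalemx sd fd.
by move=> /is_derive_eq; apply; rewrite /= retract_id.
Qed.

Lemma is_dtan_dotp n (f g : 'rV[R]_m.+1 -> 'rV[R]_n) df dg :
  is_dtan f df -> is_dtan g dg ->
  is_dtan (fun y => dotp (f y) (g y)) (dotp df (g x) + dotp (f x) dg).
Proof.
move=> fd gd; have := is_derive_dotp fd gd.
by move=> /is_derive_eq; apply; rewrite /= retract_id.
Qed.

Lemma is_dtan_dotpr w : is_dtan (fun y => dotp y w) (dotp (proj x v) w).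
Proof.
have := is_dtan_dotp is_dtan_id (is_dtan_cst w).
by move=> /is_derive_eq; apply; rewrite dotp0 addr0.
Qed.

Lemma is_dtan_dotpl w : is_dtan (fun y => dotp w y) (dotp w (proj x v)).
Proof.
have := is_dtan_dotp (is_dtan_cst w) is_dtan_id.
by move=> /is_derive_eq; apply; rewrite dot0p add0r.
Qed.

Lemma is_dtanV (s : 'rV[R]_m.+1 -> R) ds : s x != 0 -> is_dtan s ds ->
  is_dtan (fun y => (s y)^-1) (- (s x) ^- 2 * ds).
Proof.
move=> s0 sd; have := is_deriveV (f := s \o @retract R m) _ sd.
by rewrite /= retract_id// => /(_ s0).
Qed.

Lemma is_dtan_ext w :
  is_dtan (ext w) (- dotp w (proj x v) *: x - dotp w x *: proj x v).
Proof.
have := is_dtanB (is_dtan_cst w) (is_dtanZ (is_dtan_dotpl w) is_dtan_id).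
by move=> /is_derive_eq; apply; rewrite sub0r opprD scaleNr.
Qed.

End Tangential.

Lemma near_retract_sphere x : x != 0 ->
  \forall y \near x, sphere R m (retract y).
Proof.
move=> x0; near=> y; apply: retract_sphere.
by near: y; exact: (@cvgr_neq0 _ _ _ (nbhs x) _ id x cvg_id x0).
Unshelve. all: by end_near. Qed.

(** Since [retract] sends a whole neighbourhood of [x] into the sphere, a closed form valid only on
    the sphere can be substituted under [dtan]. *)
Lemma eq_dtan n (f g : 'rV[R]_m.+1 -> 'rV[R]_n) x v :
  sphere R m x -> (forall y, sphere R m y -> f y = g y) ->
  dtan f x v = dtan g x v.
Proof.
move=> /sphere_neq0/near_retract_sphere xS fg.
by apply: near_eq_derive; apply: filterS xS => y yS /=; exact: fg.
Qed.

Lemma dtan_dir0 n (f : 'rV[R]_m.+1 -> 'rV[R]_n) x : dtan f x 0 = 0.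
Proof. exact: derive0. Qed.

Lemma nabla_dir0 (X Y : 'rV[R]_m.+1 -> 'rV[R]_m.+1) x :
  X x = 0 -> nabla X Y x = 0.
Proof.
by move=> X0; rewrite /nabla X0 dtan_dir0 /proj dot0p scale0r subr0.
Qed.

(** The derivative of [ext w] has a multiple of [x], killed by the projection, and a term with
    factor [<w, x>]. Hence the extension of a vector tangent at [x] is parallel at [x]. *)
Lemma nabla_ext u w x : sphere R m x ->
  nabla (ext u) (ext w) x = - dotp w x *: proj x u.
Proof.
move=> xS; rewrite /nabla (dtanE (is_dtan_ext _ xS w)) /ext.
rewrite (proj_tangent (dotp_projl u xS)).
have /sphereP x1 := xS; have px := dotp_projl u xS.
move: (proj x u) px => pu px; rewrite /proj !(dotpD, dotpN, dotpZ) x1 px.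
by apply/rowP => j; rewrite !mxE; ring.
Qed.

(** The unit sphere has constant curvature 1. Each second covariant derivative comes from
    differentiating the closed form of [nabla_ext], which holds at every point of the sphere. *)
Lemma curvature_ext x e v : sphere R m x -> dotp e x = 0 -> dotp v x = 0 ->
  curvature (ext v) (ext e) (ext e) x = dotp e e *: v - dotp e v *: e.
Proof.
move=> xS ex vx; rewrite /curvature.
have D u w z : is_derive x z ((fun y => - dotp w y *: proj y u) \o @retract R m)
    (- dotp w (proj x z) *: proj x u
     - dotp w x *: (- dotp u (proj x z) *: x - dotp u x *: proj x z)).
  have := is_dtanZ xS (is_dtanN (is_dtan_dotpl z xS w)) (is_dtan_ext z xS u).
  by move=> /is_derive_eq; apply; rewrite /ext [X in _ + X]scaleNr.
have nn z u w : nabla (ext z) (nabla (ext u) (ext w)) x = proj x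
    (- dotp w (proj x (proj x z)) *: proj x u
     - dotp w x *: (- dotp u (proj x (proj x z)) *: x
                    - dotp u x *: proj x (proj x z))).
  rewrite {1}/nabla (eq_dtan _ xS (g := fun y => - dotp w y *: proj y u)).
    by rewrite (dtanE (D u w (ext z x))).
  by move=> y yS; rewrite nabla_ext.
have pe := proj_tangent ex; have pv := proj_tangent vx.
(* Both derivatives in the bracket equal [- <e, v> x] at [x], so the bracket of the two extensions
   vanishes there. *)
rewrite [X in _ - X](nabla_dir0 (X := bracket _ _)); last first.
  rewrite /bracket !(dtanE (is_dtan_ext _ xS _)) /ext pe pv ex vx pe pv.
  by rewrite (dotpC v e) !scale0r !subr0 subrr.
rewrite (nn v e e) (nn e v e) {nn D} subr0.
rewrite pe pv ex !scale0r !subr0 pe pv.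
have Nt k w : dotp w x = 0 -> proj x (k *: w) = k *: w.
  by move=> wx; rewrite proj_tangent// dotpZl wx mulr0.
by rewrite !Nt// !scaleNr opprK addrC.
Qed.

End SphereCalculus.

(** * Orthonormal frames, Ricci and scalar curvature *)

Section Frame.
Context {R : realType} {m : nat} (x : 'rV[R]_m.+1).
Hypotheses (xS : sphere R m x) (frame_ex : exists E, orthonormal_frame x E).

Lemma frame_orthonormal i j :
  dotp (frame x i) (frame x j) = (i == j)%:R.
Proof.
(* [xget] returns the default 0 when there is no orthonormal frame; [frame_ex] excludes this
   case. *)
rewrite /frame dotp_row; case: xgetP => [_ -> []|noE]; last first.
  by case: frame_ex => E /noE.
by move=> -> _; rewrite mxE.
Qed.

Lemma frame_tangent i : dotp (frame x i) x = 0.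
Proof.
rewrite /frame /dotp -row_mul; case: xgetP => [_ -> []|noE]; last first.
  by case: frame_ex => E /noE.
by move=> _ ->; rewrite !mxE.
Qed.

(** Stacking [x] on the frame gives a square matrix [M] with [M M^T = 1]. Then [M^T M = 1] as well,
    which expands [w] in the basis; its component along [x] is moved to the other side. *)
Lemma frame_sum w : \sum_i dotp (frame x i) w *: frame x i = proj x w.
Proof.
pose E : 'M[R]_(m, m.+1) := \matrix_i frame x i.
have EE : E *m E^T = 1%:M.
  apply/matrixP => i j; rewrite -dotp_row !rowK frame_orthonormal mxE//.
have Ex : E *m x^T = 0.
  apply/colP => i; rewrite !mxE -[RHS](frame_tangent i) dotpE.
  by apply: eq_bigr => j _; rewrite !mxE.
have xE : x *m E^T = 0 by rewrite -[x]trmxK -trmx_mul Ex trmx0.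
pose M : 'M[R]_(1 + m) := col_mx x E.
have MM : M *m M^T = 1%:M.
  rewrite /M tr_col_mx mul_col_row EE Ex xE.
  have -> : x *m x^T = 1%:M.
    by apply/matrixP => i j; rewrite !ord1 [RHS]mxE eqxx; exact/sphereP.
  by rewrite -scalar_mx_block.
have := mulmx1C MM; rewrite /M tr_col_mx mul_row_col => MM'.
have : w *m (x^T *m x + E^T *m E) = w *m (1%:M : 'M[R]_(1 + m)) by rewrite MM'.
rewrite mulmx1 mulmxDr !mulmxA => {MM'} wE.
apply/esym/eqP; rewrite /proj subr_eq addrC -[X in X == _]wE.
rewrite [w *m x^T]mx11_scalar mul_scalar_mx; apply/eqP; congr (_ + _).
rewrite mulmx_sum_row; apply: eq_bigr => i _; rewrite rowK; congr (_ *: _).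
by rewrite mxE dotpE; apply: eq_bigr => j _; rewrite !mxE mulrC.
Qed.

(** The summands are [e_j - <e_i, e_j> e_i]: the first parts add up to [m] copies of [e_j], and by
    [frame_sum] the second parts remove one. *)
Lemma Ric_frame j : Ric x (frame x j) = m.-1%:R *: frame x j.
Proof.
rewrite /Ric; under eq_bigr do
  rewrite curvature_ext ?frame_tangent// frame_orthonormal eqxx scale1r.
rewrite sumrB frame_sum proj_tangent ?frame_tangent//.
have m0 : (0 < m)%N := leq_ltn_trans (leq0n j) (ltn_ord j).
rewrite sumr_const card_ord -[X in _ *+ X](prednK m0) mulrSr addrK.
by rewrite scaler_nat.
Qed.

Lemma ScalE : Scal x = (m * m.-1)%:R.
Proof.
rewrite /Scal; under eq_bigr do
  rewrite Ric_frame dotpZl frame_orthonormal eqxx mulr1.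
by rewrite sumr_const card_ord natrM mulr_natl.
Qed.

End Frame.

(** * Conformal dilations and their energy density *)

Section Dilation.
Context {R : realType} {m : nat}.
Implicit Types (x y v w e : 'rV[R]_m.+1) (l : R).

Definition pole : 'rV[R]_m.+1 := delta_mx 0 0.

Lemma dotp_pole : dotp pole pole = 1.
Proof. by rewrite dotp_delta mxE !eqxx. Qed.

(** The square norm of [proj x pole] is [1 - <x, pole>^2]. *)
Lemma sphere_dotp_pole x : sphere R m x -> -1 <= dotp x pole <= 1.
Proof.
move=> /sphereP x1; have := dotp_ge0 (proj x pole).
rewrite /proj !(dotpD, dotpN, dotpZ) x1 dotp_pole (dotpC pole x) => x2.
by apply/andP; split; nra.
Qed.

(* The conformal dilation with pole [pole] that becomes [u |-> l u] in the chart
   [stereo]; in terms of [a = cosh (ln l)] and [b = sinh (ln l)], its conformal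
   factor is [2 l / dilation_den l x = 1 / (a + b <x, pole>)]. *)
Definition dilation_den l x : R := l ^+ 2 + 1 + (l ^+ 2 - 1) * dotp x pole.

(** Up to the factor [2 l], [dilation_den] and [dilation_num] are the time and space parts of the
    Lorentz boost along [pole], with rapidity [ln l], of the light-like vector [(1, x)]. *)
Definition dilation_num l x : 'rV[R]_m.+1 :=
  (2 * l) *: x + ((l - 1) ^+ 2 * dotp x pole + (l ^+ 2 - 1)) *: pole.

Definition dilation l x := (dilation_den l x)^-1 *: dilation_num l x.

(** The quotient rule for [dilation_num / dilation_den], with the quotient itself kept as
    [dilation l x]. *)
Definition dilation_diff l x v : 'rV[R]_m.+1 :=
  (dilation_den l x)^-1 *: ((2 * l) *: v
    + ((l - 1) ^+ 2 * dotp v pole) *: pole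
    - ((l ^+ 2 - 1) * dotp v pole) *: dilation l x).

(** With [c = <x, pole>] the denominator is [l^2 (1 + c) + (1 - c)]; both summands are nonnegative
    and they cannot vanish together. *)
Lemma dilation_den_gt0 l x : 0 < l -> sphere R m x -> 0 < dilation_den l x.
Proof.
move=> l0 /sphere_dotp_pole/andP[x1 x2].
rewrite (_ : dilation_den l x =
  l ^+ 2 * (1 + dotp x pole) + (1 - dotp x pole)); last first.
  by rewrite /dilation_den; ring.
have [->|/eqP xN1] := eqVneq (dotp x pole) (-1).
  by rewrite subrr mulr0; lra.
apply: ltr_wpDr; first by rewrite subr_ge0.
by rewrite mulr_gt0 ?exprn_gt0//; move/eqP: xN1; rewrite eq_sym; lra.
Qed.

(** A boost preserves the light cone: the square norm of the numerator equals the square of the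
    denominator when [|x| = 1]. *)
Lemma dilation_sphere l x : 0 < l -> sphere R m x ->
  sphere R m (dilation l x).
Proof.
move=> l0 xS; have D0 := dilation_den_gt0 l0 xS; have /sphereP x1 := xS.
apply/sphereP; rewrite /dilation /dilation_num !(dotpD, dotpZ) x1 dotp_pole.
rewrite (dotpC pole x); move: D0; rewrite /dilation_den => D0.
by field; rewrite gt_eqF.
Qed.

Section Derivative.
Variables (l : R) (x v : 'rV[R]_m.+1).
Hypotheses (l0 : 0 < l) (xS : sphere R m x).
Local Notation is_dtan f df := (is_derive x v (f \o @retract R m) df).

Let D0 : dilation_den l x != 0.
Proof. by rewrite gt_eqF// dilation_den_gt0. Qed.

Lemma is_dtan_dilation_den :
  is_dtan (dilation_den l) ((l ^+ 2 - 1) * dotp (proj x v) pole).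
Proof.
have := is_dtanD (is_dtan_cst x v (l ^+ 2 + 1 : R^o))
  (is_dtanM xS (is_dtan_cst x v (l ^+ 2 - 1 : R^o)) (is_dtan_dotpr v xS pole)).
by move=> /is_derive_eq; apply; rewrite mul0r !add0r.
Qed.

Lemma is_dtan_dilation :
  is_dtan (dilation l) (dilation_diff l x (proj x v)).
Proof.
have c k : is_dtan (fun=> k : R^o) 0 := is_dtan_cst x v (k : R^o).
have := is_dtanZ xS (is_dtanV xS D0 is_dtan_dilation_den) (is_dtanD
  (is_dtanZ xS (c (2 * l)) (is_dtan_id v xS))
  (is_dtanZ xS (is_dtanD (is_dtanM xS (c ((l - 1) ^+ 2))
     (is_dtan_dotpr v xS pole)) (c (l ^+ 2 - 1))) (is_dtan_cst x v pole))).
move=> /is_derive_eq; apply; rewrite /dilation_diff /dilation /dilation_num.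
by apply/rowP => j; rewrite !mxE; field.
Qed.

(** This second derivative feeds [nabla_d]. Its first summand comes from the inverse denominator,
    its last from the factor [dilation l], the others from the derivative of [ext e]. *)
Lemma is_dtan_dilation_diff e :
  is_dtan (fun y => dilation_diff l y (ext e y))
    (- (l ^+ 2 - 1) * (dilation_den l x)^-1 * dotp (proj x v) pole *:
       dilation_diff l x (ext e x)
     + (dilation_den l x)^-1 *: ((2 * l) *:
         (- dotp e (proj x v) *: x - dotp e x *: proj x v)
       + ((l - 1) ^+ 2 * dotp (- dotp e (proj x v) *: x - dotp e x *: proj x v)
           pole) *: pole
       - ((l ^+ 2 - 1) * dotp (- dotp e (proj x v) *: x
            - dotp e x *: proj x v) pole) *: dilation l x
       - ((l ^+ 2 - 1) * dotp (ext e x) pole) *: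
            dilation_diff l x (proj x v))).
Proof.
have c k : is_dtan (fun=> k : R^o) 0 := is_dtan_cst x v (k : R^o).
have de := is_dtan_ext v xS e.
have dep := is_dtan_dotp xS de (is_dtan_cst x v pole).
have := is_dtanZ xS (is_dtanV xS D0 is_dtan_dilation_den)
  (is_dtanB (is_dtanD (is_dtanZ xS (c (2 * l)) de)
     (is_dtanZ xS (is_dtanM xS (c ((l - 1) ^+ 2)) dep) (is_dtan_cst x v pole)))
   (is_dtanZ xS (is_dtanM xS (c (l ^+ 2 - 1)) dep) is_dtan_dilation)).
move=> /is_derive_eq; apply; rewrite dotp0 /=.
move: (dilation_diff l x (proj x v)) => dd; rewrite /dilation_diff.
by apply/rowP => j; rewrite !mxE; field.
Qed.

Lemma dtan_dilation : dtan (dilation l) x v = dilation_diff l x (proj x v).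
Proof. exact: dtanE is_dtan_dilation. Qed.

End Derivative.

(** * Conformality, tension field and energy density of a dilation *)

Section Energy.
Variables (l : R) (x : 'rV[R]_m.+1).
Hypotheses (l0 : 0 < l) (xS : sphere R m x).

Let D0 : dilation_den l x != 0.
Proof. by rewrite gt_eqF// dilation_den_gt0. Qed.

Lemma dilation_diff_conformal v w : dotp v x = 0 -> dotp w x = 0 ->
  dotp (dilation_diff l x v) (dilation_diff l x w)
  = (2 * l / dilation_den l x) ^+ 2 * dotp v w.
Proof.
move=> vx wx; have /sphereP x1 := xS; move: D0; rewrite /dilation_diff.
rewrite /dilation /dilation_num !(dotpD, dotpN, dotpZ) x1 dotp_pole.
rewrite (dotpC x w) !(dotpC pole) vx wx /dilation_den => D0'.
by field.
Qed.

Lemma dilation_diff_tangent v : dotp v x = 0 ->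
  dotp (dilation_diff l x v) (dilation l x) = 0.
Proof.
move=> vx; have /sphereP x1 := xS; move: D0; rewrite /dilation_diff.
rewrite /dilation /dilation_num !(dotpD, dotpN, dotpZ) x1 dotp_pole.
rewrite !(dotpC pole) vx /dilation_den => D0'.
by field.
Qed.

(** The field [proj x pole], gradient of the height [<x, pole>], generates the one-parameter group
    of dilations, so each dilation carries it to itself. *)
Lemma dilation_diff_pole :
  dilation_diff l x (proj x pole) = proj (dilation l x) pole.
Proof.
have /sphereP x1 := xS; move: D0; rewrite /dilation_diff /proj.
rewrite /dilation /dilation_num !(dotpD, dotpN, dotpZ) dotp_pole.
rewrite !(dotpC pole) /dilation_den => D0'.
by apply/rowP => j; rewrite !mxE; field.
Qed.

Lemma dilation_diff_sum (I : finType) (k : I -> R) (F : I -> 'rV[R]_m.+1) :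
  \sum_i k i *: dilation_diff l x (F i) = dilation_diff l x (\sum_i k i *: F i).
Proof.
apply: (big_ind2 (fun y z => y = dilation_diff l x z)) => [||i _].
- by rewrite /dilation_diff dot0p !(mulr0, scaler0, scale0r, subr0, addr0).
- move=> _ y _ z -> ->; rewrite /dilation_diff dotpDl.
  by apply/rowP => j; rewrite !mxE; ring.
- by rewrite /dilation_diff dotpZl; apply/rowP => j; rewrite !mxE; ring.
Qed.

(** For a conformal map with factor [c] this is the rule [2 e(ln c) d phi(e) - d phi(grad ln c)].
    Here [grad ln c] is [- (l^2 - 1) / den] times [proj x pole], and [dilation_diff_pole] gives its
    image. *)
Lemma nabla_d_dilation e : dotp e x = 0 -> dotp e e = 1 ->
  nabla_d (dilation l) (ext e) (ext e) x =
  ((l ^+ 2 - 1) / dilation_den l x) *: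
    (proj (dilation l x) pole
     - (2 * dotp e pole) *: dilation_diff l x e).
Proof.
(* [ext e] is parallel at [x], so the term with [nabla] drops out. *)
move=> ex ee; rewrite /nabla_d /pullback_nabla nabla_ext// ex oppr0 scale0r.
rewrite dtan_dir0 subr0.
rewrite (eq_dtan (g := fun y => dilation_diff l y (ext e y)) _ xS); last first.
  by move=> y yS; rewrite dtan_dilation// proj_tangent ?dotp_projl.
rewrite (dtanE (is_dtan_dilation_diff _ l0 xS e)).
have pe := proj_tangent ex; rewrite /(ext e x) pe pe ex ee.
have dt := dilation_diff_tangent ex.
have /sphereP f1 := dilation_sphere l0 xS.
move: (dilation_diff l x e) dt => d dt.
rewrite scale0r subr0.
(* [- x] enters through [dilation_num l x], which is normal to the target. *)
have xE : (2 * l) *: x = dilation_den l x *: dilation l x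
    - ((l - 1) ^+ 2 * dotp x pole + (l ^+ 2 - 1)) *: pole.
  by rewrite /dilation scalerA divff// scale1r /dilation_num addrK.
rewrite scaleN1r scalerN xE dotpNl.
move: (dilation l x) f1 dt => f f1 dt.
rewrite /proj !(dotpD, dotpN, dotpZ) dt f1.
by apply/rowP => j; rewrite !mxE; field.
Qed.

Hypothesis frame_ex : exists E, orthonormal_frame x E.

(** In the trace the first term of [nabla_d_dilation] occurs [m] times, while [frame_sum] and
    [dilation_diff_pole] turn the second into 2 copies of the same vector; hence the factor
    [m - 2]. *)
Lemma tension_dilation :
  tension (dilation l) x =
  ((m%:R - 2) * ((l ^+ 2 - 1) / dilation_den l x)) *:
    proj (dilation l x) pole.
Proof.
rewrite /tension; under eq_bigr do
  rewrite nabla_d_dilation ?frame_tangent ?frame_orthonormal ?eqxx//.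
rewrite -scaler_sumr sumrB sumr_const card_ord.
have -> : \sum_(i < m) (2 * dotp (frame x i) pole) *:
    dilation_diff l x (frame x i) = 2 *: proj (dilation l x) pole.
  under eq_bigr do rewrite -scalerA.
  by rewrite -scaler_sumr dilation_diff_sum frame_sum// dilation_diff_pole.
by rewrite -scaler_nat -scalerBl scalerA mulrC.
Qed.

Lemma energy_density_dilation :
  dotp (tension (dilation l) x) (tension (dilation l) x)
    + 2 / 3 * Scal x * normsq_d (dilation l) x - 2 * ric_term (dilation l) x =
  (m%:R - 2) ^+ 2 * (l ^+ 2 - 1) ^+ 2 * (2 * l) ^+ 2
    * (1 - dotp x pole ^+ 2) / dilation_den l x ^+ 4
  + (2 / 3 * m%:R - 2) * m%:R * m.-1%:R * (2 * l) ^+ 2 / dilation_den l x ^+ 2.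
Proof.
have dd i : dotp (dtan (dilation l) x (frame x i))
    (dtan (dilation l) x (frame x i)) = (2 * l / dilation_den l x) ^+ 2.
  rewrite dtan_dilation// proj_tangent ?frame_tangent//.
  rewrite dilation_diff_conformal ?frame_tangent//.
  by rewrite frame_orthonormal// eqxx mulr1.
have nd : normsq_d (dilation l) x = m%:R * (2 * l / dilation_den l x) ^+ 2.
  rewrite /normsq_d; under eq_bigr do rewrite dd.
  by rewrite sumr_const card_ord -[LHS]mulr_natl.
have rt : ric_term (dilation l) x =
    m.-1%:R * (m%:R * (2 * l / dilation_den l x) ^+ 2).
  rewrite -nd /normsq_d mulr_sumr /ric_term; apply: eq_bigr => i _.
  rewrite Ric_frame// -dotpZl !dtan_dilation//; congr (dotp _ _).
  rewrite /proj !dotpZl frame_tangent// !mulr0 !scale0r !subr0.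
  (* A sum with a single term gives homogeneity of [dilation_diff]. *)
  have := @dilation_diff_sum 'I_1 (fun=> m.-1%:R) (fun=> frame x i).
  by rewrite !big_ord1.
have /sphereP f1 := dilation_sphere l0 xS.
(* The norm at the image point is computed at [x]: the vector is the image of [proj x pole], and the
   differential is conformal. *)
have tt : dotp (proj (dilation l x) pole) (proj (dilation l x) pole) =
    (2 * l / dilation_den l x) ^+ 2 * (1 - dotp x pole ^+ 2).
  rewrite -dilation_diff_pole dilation_diff_conformal ?dotp_projl//.
  rewrite /proj !(dotpD, dotpN, dotpZ) dotp_pole (dotpC pole).
  by have /sphereP -> := xS; congr (_ * _); ring.
rewrite nd rt ScalE// tension_dilation !dotpZ tt natrM; move: D0 => D0'.
by field.
Qed.

End Energy.

End Dilation.

(** * The stereographic chart: conformality, frames and volume density *)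

Section Stereographic.
Context {R : realType} {m : nat}.
Implicit Types (u v w : 'rV[R]_m).
Local Notation pole := (@pole R m).

(** The matrix of [u |-> (0, u)], which separates the component of [stereo u] along [pole] from the
    rest. *)
Definition equator : 'M[R]_(m, 1 + m) := row_mx (0 : 'M[R]_(m, 1)) 1%:M.

Lemma dotp_equator u v : dotp (u *m equator) (v *m equator) = dotp u v.
Proof.
rewrite /dotp trmx_mul mulmxA -(mulmxA u) /equator tr_row_mx mul_row_col.
by rewrite mul0mx add0r trmx1 !mulmx1.
Qed.

Lemma dotp_equator_pole u : dotp (u *m equator) pole = 0.
Proof.
rewrite /pole dotp_delta /equator mul_mx_row.
have -> : (0 : 'I_m.+1) = lshift m (0 : 'I_1) by apply/val_inj.
by rewrite row_mxEl mulmx0 mxE.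
Qed.

Definition stereo_num u : 'rV[R]_m.+1 :=
  (dotp u u - 1) *: pole + 2 *: (u *m equator).

Lemma stereoE u : stereo u = (dotp u u + 1)^-1 *: stereo_num u.
Proof.
rewrite /stereo; congr (_ *: _); rewrite /stereo_num /equator mul_mx_row.
rewrite mulmx0 mulmx1; apply/rowP => j; rewrite !mxE.
case: splitP => k jk; rewrite !mxE -!val_eqE /= jk ?ord1 /=.
  by rewrite mulr1 mulr0 addr0.
by rewrite mulr0 add0r.
Qed.

Lemma stereo_den_gt0 u : 0 < dotp u u + 1.
Proof. by rewrite ltr_wpDl// dotp_ge0. Qed.

Let den_neq0 u : dotp u u + 1 != 0.
Proof. by rewrite gt_eqF// stereo_den_gt0. Qed.

Lemma stereo_sphere u : sphere R m (stereo u).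
Proof.
apply/sphereP; rewrite stereoE /stereo_num !(dotpD, dotpZ) dotp_pole.
rewrite (dotpC pole) dotp_equator_pole dotp_equator.
by field; exact: den_neq0.
Qed.

Lemma dotp_stereo_pole u :
  dotp (stereo u) pole = (dotp u u - 1) / (dotp u u + 1).
Proof.
rewrite stereoE /stereo_num !(dotpD, dotpZ) dotp_pole dotp_equator_pole.
by field; exact: den_neq0.
Qed.

Lemma is_derive_stereo u v : is_derive u v (@stereo R m)
  (- (dotp u u + 1) ^- 2 * (2 * dotp u v) *: stereo_num u
   + (dotp u u + 1)^-1 *: ((2 * dotp u v) *: pole + 2 *: (v *m equator))).
Proof.
have dq : is_derive u v (fun y => dotp y y) (dotp v u + dotp u v).
  by apply: is_derive_dotp; exact: is_derive_id.
have dJ : is_derive u v (fun y => y *m equator) (v *m equator).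
  exact: is_derive_mulmxr.
rewrite (funext stereoE).
have c (W : normedModType R) (k : W) : is_derive u v (fun=> k) 0.
  exact: is_derive_cst.
have dd : is_derive u v (fun y => dotp y y + 1) (dotp v u + dotp u v + 0).
  exact: is_deriveD dq (c _ (1 : R^o)).
have dn : is_derive u v (fun y => dotp y y - 1) (dotp v u + dotp u v - 0).
  exact: is_deriveB dq (c _ (1 : R^o)).
have := is_derive_scalemx
  (is_deriveV (f := fun y => dotp y y + 1) (den_neq0 u) dd)
  (is_deriveD (is_derive_scalemx dn (c _ pole))
    (is_derive_scalemx (c _ (2 : R^o)) dJ)).
move=> /is_derive_eq; apply; rewrite (dotpC v u) /stereo_num.
apply/rowP => j; rewrite !mxE; field; exact: den_neq0.
Qed.

Lemma differentiable_stereo u : differentiable (@stereo R m) u.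
Proof.
have dq : differentiable (fun y : 'rV[R]_m => dotp y y) u.
  exact: differentiable_dotp.
rewrite (funext stereoE); apply: differentiable_scale.
  by apply: differentiableV => //; apply: differentiableD.
apply: differentiableD.
  by apply: differentiable_scale => //; exact: differentiableB.
by apply: differentiableZ; exact: differentiable_mulmxr.
Qed.

(** The chart is conformal, so the Gram matrix of the coordinate fields is scalar. This gives the
    volume density and, after rescaling the rows, an orthonormal frame. *)
Lemma jacobian_stereo_orthogonal u :
  jacobian (@stereo R m) u *m (jacobian (@stereo R m) u)^T
  = ((2 / (dotp u u + 1)) ^+ 2)%:M.
Proof.
apply/matrixP => i j; rewrite -dotp_row !rowE.
rewrite -!deriveEjacobian; try exact: differentiable_stereo.
have D v := @derive_val _ _ _ _ _ _ _ (is_derive_stereo u v).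
rewrite !D /stereo_num !(dotpD, dotpZ) dotp_pole !(dotpC pole).
rewrite !dotp_equator_pole !dotp_equator (dotpC _ u) !dotp_delta !mxE !eqxx.
rewrite /= eq_sym.
by rewrite -[RHS]mulr_natr; field; exact: den_neq0.
Qed.

Lemma jacobian_stereo_tangent u :
  jacobian (@stereo R m) u *m (stereo u)^T = 0.
Proof.
apply/colP => i; rewrite [RHS]mxE.
have -> : (jacobian (@stereo R m) u *m (stereo u)^T) i 0 =
    dotp (row i (jacobian (@stereo R m) u)) (stereo u).
  by rewrite /dotp -row_mul [RHS]mxE.
rewrite rowE -deriveEjacobian; last exact: differentiable_stereo.
rewrite (@derive_val _ _ _ _ _ _ _ (is_derive_stereo u _)) stereoE.
rewrite /stereo_num !(dotpD, dotpZ) dotp_pole !(dotpC pole).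
rewrite !dotp_equator_pole !dotp_equator (dotpC _ u).
by field; exact: den_neq0.
Qed.

(** This supplies the hypothesis [frame_ex] at every point that the integral sees. *)
Lemma orthonormal_frame_stereo u : exists E, orthonormal_frame (stereo u) E.
Proof.
exists (((dotp u u + 1) / 2) *: jacobian (@stereo R m) u); split.
  rewrite -scalemxAl linearZ/= -scalemxAr jacobian_stereo_orthogonal.
  rewrite !scale_scalar_mx.
  by congr (_%:M); field; exact: den_neq0.
by rewrite -scalemxAl jacobian_stereo_tangent scaler0.
Qed.

Lemma vol_density_stereo u : vol_density u = (2 / (dotp u u + 1)) ^+ m.
Proof.
rewrite /vol_density jacobian_stereo_orthogonal det_scalar -exprM mulnC exprM.
by rewrite sqrtr_sqr ger0_norm// exprn_ge0// divr_ge0// ltW// stereo_den_gt0.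
Qed.

End Stereographic.

(** * Smoothness and homotopy to the identity *)

Section DilationSmooth.
Context {R : realType} {m : nat} (l : R).
Hypothesis l0 : 0 < l.
Implicit Types (y v : 'rV[R]_m.+1).
Local Notation pole := (@pole R m).
Local Notation den := (@dilation_den R m l).

(* Directional derivatives preserve this shape, so it is the shape of every
   iterated derivative of [dilation l]. *)
Definition rational_form k (p : 'rV[R]_m.+1) (M : 'M[R]_m.+1) y :
  'rV[R]_m.+1 := den y ^- k.+1 *: (p + y *m M).

Let dotp_pole_mul y v : y *m (pole^T *m v) = dotp y pole *: v.
Proof. by rewrite mulmxA [y *m _]mx11_scalar mul_scalar_mx. Qed.

Lemma differentiable_dilation_den y : differentiable den y.
Proof.
apply: differentiableD => //; apply: differentiableM => //.
exact: differentiable_dotp.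
Qed.

Lemma differentiable_rational_form k p M y :
  den y != 0 -> differentiable (rational_form k p M) y.
Proof.
move=> D0; apply: differentiable_scale.
  apply: differentiableV; last by rewrite expf_neq0.
  have := differentiableX k (differentiable_dilation_den y).
  by rewrite exprfctE.
by apply: differentiableD => //; exact: differentiable_mulmxr.
Qed.

(** The term [v *m M] is brought over the higher power by multiplying it with [den y]. As [den] is
    affine in [y], the numerator stays affine and only the exponent grows. *)
Lemma derive_rational_form k p M v y : den y != 0 ->
  'D_v (rational_form k p M) y =
  rational_form k.+1
    ((l ^+ 2 + 1) *: (v *m M) - (k.+1%:R * (l ^+ 2 - 1) * dotp v pole) *: p)
    ((l ^+ 2 - 1) *: (pole^T *m (v *m M))
     - (k.+1%:R * (l ^+ 2 - 1) * dotp v pole) *: M) y.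
Proof.
move=> D0.
have c (W : normedModType R) (w : W) : is_derive y v (fun=> w) 0.
  exact: is_derive_cst.
have dd : is_derive y v den ((l ^+ 2 - 1) * dotp v pole).
  have := is_deriveD (c _ (l ^+ 2 + 1 : R^o))
    (is_deriveM (c _ (l ^+ 2 - 1 : R^o))
      (is_derive_dotp (is_derive_id y v) (c _ pole))).
  move=> /is_derive_eq; apply.
  by rewrite scaler0 dotp0 addr0 add0r addr0.
have Dk0 : (den ^+ k.+1) y != 0 by rewrite exprfctE expf_neq0.
have := is_derive_scalemx (is_deriveV Dk0 (is_deriveX k.+1 dd))
  (is_deriveD (c _ p) (is_derive_mulmxr M y v)).
have -> : (fun z => ((den ^+ k.+1) z)^-1 *:
    ((fun=> p) + (fun z => z *m M)) z) = rational_form k p M.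
  by apply/funext => z; rewrite /rational_form exprfctE.
move=> dr; rewrite (@derive_val _ _ _ _ _ _ _ dr) exprfctE /rational_form.
rewrite mulmxBr -!scalemxAr dotp_pole_mul /= add0r.
have -> : ((fun=> p) + (fun z => z *m M)) y = p + y *m M by [].
move: (y *m M) (v *m M) => yM vM.
have Dk : den y ^+ k != 0 by rewrite expf_neq0.
rewrite !exprS; move: (den y ^+ k) Dk D0 => Dk Dk0'.
rewrite /dilation_den => D0.
apply/rowP => j; rewrite ![_ *: _]/GRing.scale/=.
rewrite !mxE.
by field; rewrite D0 Dk0'.
Qed.

Lemma open_dilation_den : open [set y | den y != 0].
Proof.
rewrite (_ : [set y | _] = den @^-1` [set t | t != 0]); last by [].
apply: open_comp => [y _|]; last exact: open_neq.
exact: differentiable_continuous (differentiable_dilation_den y).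
Qed.

(** The equality holds on the open set where the denominator is nonzero, so it can be differentiated
    again at each induction step. *)
Lemma iter_derive_dilation vs : exists k p M, forall y,
  den y != 0 -> iter_derive vs (@dilation R m l) y = rational_form k p M y.
Proof.
elim: vs => [|v vs [k [p [M IH]]]] /=.
  exists 0, ((l ^+ 2 - 1) *: pole),
    ((2 * l)%:M + (l - 1) ^+ 2 *: (pole^T *m pole)) => y D0.
  rewrite /rational_form expr1 /dilation /dilation_num mulmxDr mul_mx_scalar.
  rewrite -scalemxAr dotp_pole_mul scalerA; congr (_ *: _).
  by rewrite scalerDl addrA [RHS]addrC.
exists k.+1; do 2 eexists; move=> y D0.
apply: etrans (derive_rational_form _ _ _ _ D0).
apply: near_eq_derive; apply: filterS IH _.
exact: (open_nbhs_nbhs (conj open_dilation_den D0)).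
Qed.

Lemma dilation_smooth : smooth_map (sphere R m) (@dilation R m l).
Proof.
move=> x xS; exists [set y | den y != 0], (dilation l); split => //=.
- exact: open_dilation_den.
- by rewrite gt_eqF// dilation_den_gt0.
move=> vs v y /= D0; have [k [p [M vsE]]] := iter_derive_dilation vs.
have nE : \near y, rational_form k p M y = iter_derive vs (@dilation R m l) y.
  apply: filterS (fun z D0 => esym (vsE z D0)) _.
  exact: (open_nbhs_nbhs (conj open_dilation_den D0)).
have dr := differentiable_rational_form k p M D0.
split; first exact: near_eq_derivable nE (diff_derivable dr).
rewrite /prop_for /continuous_at vsE//.
by apply: cvg_trans (differentiable_continuous dr); exact: near_eq_cvg nE.
Qed.

(** The parameter moves linearly from [l] to 1 and stays positive, so every intermediate map is a
    dilation; the dilation with parameter 1 is the identity. *)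
Lemma dilation_homotopic :
  homotopic R (sphere R m) (sphere R m) (@dilation R m l) id.
Proof.
pose L (t : R) := (1 - t) * l + t.
have L0 t : t \in `[0, 1] -> 0 < L t.
  rewrite in_itv/= /L => /andP[t0 t1].
  have [->|tn0] := eqVneq t 0; first by rewrite subr0 mul1r addr0.
  by rewrite ltr_wpDl// ?mulr_ge0 ?subr_ge0// ?ltW// lt0r tn0.
exists (fun z => dilation (L z.2) z.1); split.
(* Continuity holds even in the ambient space at these points, because the denominator is nonzero
   there. *)
- apply: continuous_in_subspaceT => -[x t]; rewrite inE/= => -[/= xS tI].
  have D0 := dilation_den_gt0 (L0 _ tI) xS.
  have cx : z.1 @[z --> (x, t)] --> x by exact: cvg_fst.
  have ct : z.2 @[z --> (x, t)] --> t by exact: cvg_snd.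
  have cL : L z.2 @[z --> (x, t)] --> L t.
    apply: cvgD => //; apply: cvgM; last exact: cvg_cst.
    by apply: cvgB => //; exact: cvg_cst.
  have cp : dotp z.1 pole @[z --> (x, t)] --> dotp x pole.
    have /differentiable_continuous cd : 
        differentiable (fun y : 'rV[R]_m.+1 => dotp y pole) x.
      exact: differentiable_dotp.
    exact: (cvg_comp _ _ cx cd).
  have cL2 : L z.2 ^+ 2 @[z --> (x, t)] --> L t ^+ 2 by exact: cvgM.
  have c (a : R) : a @[z --> (x, t)] --> a by exact: cvg_cst.
  apply: cvgZ.
    apply: cvgV; first by rewrite gt_eqF.
    by apply: cvgD; [apply: cvgD|apply: cvgM => //; apply: cvgB].
  apply: cvgD; first by apply: cvgZ => //; exact: cvgM.
  apply: cvgZ; last exact: cvg_cst.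
  apply: cvgD; last exact: cvgB.
  by apply: cvgM => //; apply: cvgM; exact: cvgB.
- by move=> [x t] /= [xS tI]; apply: dilation_sphere => //; exact: L0.
- by move=> x _; rewrite /L /= subr0 mul1r addr0.
- move=> x _; rewrite /L /= subrr mul0r add0r /dilation /dilation_num.
  rewrite /dilation_den expr1n !subrr mul0r expr0n/= mul0r !addr0 scale0r addr0.
  by rewrite mulr1 scalerA mulVf ?scale1r.
Qed.

End DilationSmooth.

(** * Estimate of the energy integral *)

Section KernelIntegral.
Context {R : realType}.
Implicit Types (l s t : R).
Local Notation mu := (@lebesgue_measure R).

(** Comparable to [(1 + l^2 s^2)^(-3/5)], but with an elementary primitive on the half-line. *)
Definition kernel l s : R := (1 + l * `|s|) `^ (- (6 / 5)).

Lemma continuous_powR (a t : R) : 0 < t ->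
  {for t, continuous (fun s : R => s `^ a)}.
Proof.
move=> t0; apply: differentiable_continuous; apply/derivable1_diffP.
by apply: derivable_powR; rewrite in_itv/= t0.
Qed.

Lemma kernel_ge0 l s : 0 <= kernel l s.
Proof. exact: powR_ge0. Qed.

Lemma continuous_kernel l : 0 <= l -> continuous (kernel l).
Proof.
move=> l0 s; have p0 : 0 < 1 + l * `|s| by rewrite ltr_pwDl// mulr_ge0.
have cf : 1 + l * `|r| @[r --> s] --> 1 + l * `|s|.
  apply: cvgD; first exact: cvg_cst.
  by apply: cvgM; [exact: cvg_cst|exact: norm_continuous].
have cg : x `^ (- (6 / 5)) @[x --> 1 + l * `|s|] -->
    (1 + l * `|s|) `^ (- (6 / 5)).
  exact: continuous_powR.
exact: (cvg_comp _ _ cf cg).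
Qed.

Lemma integral_kernel l : 0 < l ->
  (\int[mu]_s (kernel l s)%:E = (10 / l)%:E)%E.
Proof.
move=> l0; rewrite ge0_symfun_integralT; first last.
- by move=> s; rewrite /kernel /= normrN.
- exact/continuous_kernel/ltW.
- exact: kernel_ge0.
have pos s : 0 <= s -> 0 < 1 + l * s.
  by move=> s0; rewrite ltr_pwDl// mulr_ge0// ltW.
(* A primitive on the half-line that vanishes at infinity and equals [- 5 / l] at 0; evenness of the
   kernel doubles the contribution to [10 / l]. *)
pose F s := - (5 / l) * (1 + l * s) `^ (- (1 / 5)).
have dF s : 0 <= s -> is_derive s 1 F (kernel l s).
  move=> s0; have p0 := pos s s0.
  have d1 : is_derive s 1 (fun s => 1 + l * s) l.
    have := is_deriveD (is_derive_cst (1 : R^o) s 1)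
      (is_deriveZ l (is_derive_id s (1 : R))).
    by move=> /is_derive_eq; apply; rewrite add0r [LHS]mulr1.
  have d2 : is_derive (1 + l * s) 1 (fun x : R => x `^ (- (1 / 5)))
      (- (1 / 5) * (1 + l * s) `^ (- (1 / 5) - 1)).
    apply: DeriveDef; first by apply: derivable_powR; rewrite in_itv/= p0.
    by rewrite -derive1E powR_derive1// in_itv/= p0.
  have := is_deriveZ (- (5 / l)) (is_derive_comp1 d1 d2).
  move=> /is_derive_eq; apply; rewrite /kernel ger0_norm//.
  have -> : - (1 / 5) - 1 = - (6 / 5) :> R by field.
  by rewrite [LHS]/GRing.scale/=; field; rewrite gt_eqF.
have -> : [set s : R | 0 <= s] = `[0, +oo[%classic.
  by apply/seteqP; split => s /=; rewrite in_itv/= andbT.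
rewrite (@ge0_continuous_FTC2y _ _ F _ 0).
- rewrite /F mulr0 addr0 powR1 mulr1 -EFinB -EFinM; congr (_%:E).
  by field; rewrite gt_eqF.
- by move=> s _; exact: kernel_ge0.
- by apply: continuous_subspaceT; exact/continuous_kernel/ltW.
- apply/cvgrPdist_le => e e0.
  (* [|F s| <= e] means [N <= (1 + l s)^(1/5)], that is [N^5 <= 1 + l s], which holds for large
     [s]. *)
  pose N := e^-1 * (5 / l).
  have N0 : 0 < N by rewrite mulr_gt0 ?invr_gt0 ?divr_gt0.
  near=> s.
  have s0 : 0 <= s by near: s; exact: nbhs_pinfty_ge.
  rewrite sub0r normrN /F normrM normrN (ger0_norm (powR_ge0 _ _)).
  rewrite gtr0_norm ?divr_gt0// powRN ler_pdivrMr ?powR_gt0 ?pos//.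
  rewrite -ler_pdivrMl//.
  rewrite -/N; have -> : N = (N ^+ 5) `^ (1 / 5).
    rewrite -powR_mulrn ?ltW// -powRrM.
    by rewrite (_ : 5 * (1 / 5) = 1 :> R) ?powRr1 ?ltW//; field.
  apply: ge0_ler_powR; rewrite ?nnegrE ?exprn_ge0 ?(ltW N0) ?(ltW (pos s s0))//.
  rewrite -lerBlDl -ler_pdivrMl//.
- by move=> s s0; exact: (@ex_derive _ _ _ _ _ _ _ (dF s (ltW s0))).
- apply: cvg_at_right_filter; apply: differentiable_continuous.
  by apply/derivable1_diffP; exact: (@ex_derive _ _ _ _ _ _ _ (dF 0 (lexx 0))).
- move=> s; rewrite in_itv/= andbT => s0; rewrite derive1E.
  exact: (@derive_val _ _ _ _ _ _ _ (dF s (ltW s0))).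
Unshelve. all: by end_near. Qed.

End KernelIntegral.

(** Tonelli, splitting off the first coordinate. Indexing [G] and [c] by [nat] lets the induction
    hypothesis apply to the shifted families. *)
Lemma integral_lebesgue_tuple_prod (R : realType) n (G : nat -> R -> R)
    (c : nat -> R) :
  (forall i s, 0 <= G i s) -> (forall i, measurable_fun setT (G i)) ->
  (forall i, (\int[@lebesgue_measure R]_s (G i s)%:E = (c i)%:E)%E) ->
  (\int[lebesgue_tuple R n]_t (\prod_(i < n) G i (tnth t i))%:E
    = (\prod_(i < n) c i)%:E)%E.
Proof.
elim: n G c => [|n IH] G c G0 mG Gc /=.
  (* In dimension 0 the measure is the Dirac mass at the empty tuple. *)
  under eq_integral do rewrite big_ord0.
  by rewrite integral_dirac// diracT mul1e big_ord0.
have mp k (H : nat -> R -> R) : (forall i, measurable_fun setT (H i)) ->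
    measurable_fun setT (fun t : k.-tuple (measurableTypeR R) =>
      \prod_(i < k) H i (tnth t i)).
  move=> mH; apply: measurable_prod => i _.
  by apply: (measurableT_comp (mH i)); exact: measurable_tnth.
have p0 k (H : nat -> R -> R) (t : k.-tuple R) : (forall i s, 0 <= H i s) ->
    0 <= \prod_(i < k) H i (tnth t i).
  by move=> H0; apply: prodr_ge0 => i _.
have c0 i : 0 <= c i.
  by rewrite -lee_fin -Gc; apply: integral_ge0 => s _; rewrite lee_fin.
rewrite ge0_integral_pushforward//; last first.
- by move=> t _; rewrite lee_fin p0.
- by apply/measurable_EFinP; exact: mp.
- exact: measurable_cons_pair.
pose G' i := G i.+1.
have IH' := IH G' (fun i => c i.+1) (fun i => G0 i.+1) (fun i => mG i.+1)
  (fun i => Gc i.+1).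
have E (p : measurableTypeR R * n.-tuple (measurableTypeR R)) :
    (\prod_(i < n.+1) G i (tnth (cons_pair p) i))%:E =
    (G 0 p.1 * \prod_(i < n) G' i (tnth p.2 i))%:E.
  rewrite big_ord_recl; congr (_ * _)%:E.
  by apply: eq_bigr => i _; rewrite /cons_pair !(tnth_nth 0).
under eq_integral do rewrite /= E.
rewrite preimage_setT fubini_tonelli1; last 2 first.
- apply/measurable_EFinP; apply: measurable_funM.
    exact: (measurableT_comp (mG 0%N) measurable_fst).
  exact: (measurableT_comp (mp n G' (fun i => mG i.+1)) measurable_snd).
- by move=> p; rewrite lee_fin mulr_ge0// p0// => i s; exact: G0.
under eq_integral => s _.
  rewrite /fubini_F /=; under eq_integral do rewrite EFinM.
  rewrite ge0_integralZl_EFin//; last 2 first.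
  - by move=> t _; rewrite lee_fin p0// => i r; exact: G0.
  - by apply/measurable_EFinP; apply: mp => i; exact: mG.
  rewrite IH' muleC; over.
rewrite ge0_integralZl_EFin//; last 3 first.
- by move=> s _; rewrite lee_fin.
- by apply/measurable_EFinP; exact: mG.
- by apply: prodr_ge0 => i _.
by rewrite Gc big_ord_recl -EFinM mulrC.
Qed.

(** * Energy of a dilation in the chart and its bound by a product of kernels *)

Section EnergyBound.
Context {R : realType}.
Implicit Types (l q s : R) (m n : nat).

(** Energy density times volume density at [q = |u|^2]. The first fraction is the volume density;
    the factor [l^2 (1 + q)^2] appears because the dilation denominator is [2 (1 + l^2 q) / (1 + q)]
    in the chart. *)
Definition energy_profile m l q : R :=
  2 ^+ m / (1 + q) ^+ m * (l ^+ 2 * (1 + q) ^+ 2) *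
  ((m%:R - 2) ^+ 2 * (l ^+ 2 - 1) ^+ 2 * q / (1 + l ^+ 2 * q) ^+ 4
   + (2 / 3 * m%:R - 2) * m%:R * m.-1%:R / (1 + l ^+ 2 * q) ^+ 2).

Lemma energy_profileE m l (u : 'rV[R]_m) (phi := @dilation R m l)
    (x := stereo u) : 0 < l ->
  (dotp (tension phi x) (tension phi x)
     + 2 / 3 * Scal x * normsq_d phi x - 2 * ric_term phi x) * vol_density u
  = energy_profile m l (dotp u u).
Proof.
move=> l0; rewrite /phi /x energy_density_dilation//; last 2 first.
- exact: stereo_sphere.
- exact: orthonormal_frame_stereo.
have q0 := dotp_ge0 u; move: (dotp u u) (dotp_stereo_pole u)
  (vol_density_stereo u) q0 => q Xq vq q0.
rewrite vq /energy_profile /dilation_den Xq (expr_div_n 2 (q + 1) m).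
have Q0 : q + 1 != 0 by rewrite gt_eqF// ltr_wpDl.
have P0 : 1 + l ^+ 2 * q != 0 by rewrite gt_eqF// ltr_pwDl// mulr_ge0// sqr_ge0.
have -> : l ^+ 2 + 1 + (l ^+ 2 - 1) * ((q - 1) / (q + 1)) =
    2 * (1 + l ^+ 2 * q) / (q + 1) by field.
rewrite (addrC 1 q); have : (q + 1) ^+ m != 0 by rewrite expf_neq0.
move: ((q + 1) ^+ m) (2 ^+ m) => Qm tm Qm0.
by field; rewrite Qm0 Q0 P0.
Qed.

(** The absolute value keeps the denominators positive on the whole line, so continuity, and with it
    measurability, is global. *)
Lemma continuous_energy_profile m l :
  continuous (fun q => energy_profile m l `|q|).
Proof.
have cX (f : R -> R) (r : R) k : 
    f q @[q --> r] --> f r -> f q ^+ k @[q --> r] --> f r ^+ k.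
  by move=> fr; exact: (cvg_comp _ _ fr (@exprn_continuous _ k _)).
move=> r; have ca : `|q| @[q --> r] --> `|r| by exact: norm_continuous.
have cQ : 1 + `|q| @[q --> r] --> 1 + `|r|.
  by apply: cvgD => //; exact: cvg_cst.
have cP : 1 + l ^+ 2 * `|q| @[q --> r] --> 1 + l ^+ 2 * `|r|.
  by apply: cvgD; [exact: cvg_cst|apply: cvgM => //; exact: cvg_cst].
have Q0 k : (1 + `|r|) ^+ k != 0 by rewrite expf_neq0// gt_eqF// ltr_pwDl.
have P0 k : (1 + l ^+ 2 * `|r|) ^+ k != 0.
  by rewrite expf_neq0// gt_eqF// ltr_pwDl// mulr_ge0// sqr_ge0.
apply: cvgM.
  apply: cvgM.
    apply: cvgM; first exact: cvg_cst.
    by apply: cvgV => //; exact: (cX (fun q => 1 + `|q|)).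
  by apply: cvgM; [exact: cvg_cst|exact: (cX (fun q => 1 + `|q|))].
apply: cvgD; apply: cvgM.
- by apply: cvgM => //; exact: cvg_cst.
- by apply: cvgV => //; exact: (cX (fun q => 1 + l ^+ 2 * `|q|)).
- exact: cvg_cst.
- by apply: cvgV => //; exact: (cX (fun q => 1 + l ^+ 2 * `|q|)).
Qed.

Definition energy_constant m : R :=
  2 ^+ m * ((m%:R - 2) ^+ 2 + (2 / 3 * m%:R - 2) * m%:R * m.-1%:R).

Lemma energy_coef_ge0 m : (3 <= m)%N ->
  0 <= (2 / 3 * m%:R - 2) * m%:R * m.-1%:R :> R.
Proof.
rewrite -(ler_nat R) => m3.
by apply: mulr_ge0 => //; apply: mulr_ge0 => //; lra.
Qed.

Lemma energy_constant_ge0 m : (3 <= m)%N -> 0 <= energy_constant m.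
Proof.
move=> m3; apply: mulr_ge0; first exact: exprn_ge0.
by apply: addr_ge0; [exact: sqr_ge0|exact: energy_coef_ge0].
Qed.

Lemma energy_profile_ge0 m l q : (3 <= m)%N -> 0 <= q ->
  0 <= energy_profile m l q.
Proof.
move=> m3 q0.
have P0 : 0 <= 1 + l ^+ 2 * q by rewrite addr_ge0// mulr_ge0// sqr_ge0.
have Q0 : 0 <= 1 + q by rewrite addr_ge0.
apply: mulr_ge0.
  apply: mulr_ge0; last by apply: mulr_ge0; exact: sqr_ge0.
  by apply: divr_ge0; exact: exprn_ge0.
apply: addr_ge0; apply: divr_ge0; rewrite ?exprn_ge0//.
  by apply: mulr_ge0 => //; apply: mulr_ge0; exact: sqr_ge0.
exact: energy_coef_ge0.
Qed.

(** With [L = l^2], [Q = 1 + q] and [P = 1 + l^2 q], both summands are bounded by [L^2 / P^3] once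
    [2^m / Q^n] is taken out. *)
Lemma energy_profile_le n l q : 1 <= l -> 0 <= q ->
  energy_profile (5 + n) l q <= energy_constant (5 + n) * l ^+ 4 *
    ((1 + l ^+ 2 * q) ^+ 3 * (1 + q) ^+ n)^-1.
Proof.
move=> l1 q0; rewrite /energy_profile /energy_constant.
have C0 : 0 <= _ := @energy_coef_ge0 (5 + n) isT.
have A0 := sqr_ge0 ((5 + n)%:R - 2 : R).
move: (2 / 3 * _ - 2) C0 => c; move: (c * _ * _) => C C0.
move: (((5 + n)%:R - 2) ^+ 2 : R) A0 => A A0.
have Q1 : 1 <= 1 + q by rewrite lerDl.
have L1 : 1 <= l ^+ 2 by rewrite exprn_ege1.
have P1 : 1 <= 1 + l ^+ 2 * q by rewrite lerDl mulr_ge0// sqr_ge0.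
have PQ : 1 + l ^+ 2 * q <= l ^+ 2 * (1 + q) by rewrite mulrDr mulr1 lerD2r.
have qP : l ^+ 2 * q <= 1 + l ^+ 2 * q by rewrite lerDr.
have l4 : l ^+ 4 = l ^+ 2 * l ^+ 2 by rewrite -exprD.
rewrite l4 (exprD (1 + q)).
move: (l ^+ 2) (1 + q) (1 + l ^+ 2 * q) Q1 P1 L1 PQ qP.
move=> L Q P Q1 P1 L1 PQ qP.
have Q0 : 0 < Q by exact: (lt_le_trans ltr01 Q1).
have P0 : 0 < P by exact: (lt_le_trans ltr01 P1).
have L0 : 0 < L by exact: (lt_le_trans ltr01 L1).
have Q2 : 1 <= Q ^+ 2 by exact: exprn_ege1.
have Q3 : 1 <= Q ^+ 3 by exact: exprn_ege1.
(* Tension part: [(L - 1)^2 <= L^2] and [L q <= P]. *)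
have ha : L * (L - 1) ^+ 2 * q / (P ^+ 4 * Q ^+ 3) <= L * L / P ^+ 3.
  rewrite ler_pdivrMr ?mulr_gt0 ?exprn_gt0//.
  have -> : L * L / P ^+ 3 * (P ^+ 4 * Q ^+ 3) = L * L * P * Q ^+ 3.
    by field; rewrite gt_eqF.
  apply: (@le_trans _ _ (L * L * P)); last first.
    by rewrite ler_peMr// ltW// !mulr_gt0.
  rewrite -(mulrA L _ q) -(mulrA L L P) ler_pM2l//.
  apply: (@le_trans _ _ (L ^+ 2 * q)).
    rewrite ler_wpM2r// lerXn2r ?nnegrE ?subr_ge0 ?(ltW L0)//.
    by rewrite gerBl.
  by rewrite expr2 -mulrA ler_pM2l.
(* Curvature part: [P <= L Q <= L Q^3]. *)
have hb : L / (P ^+ 2 * Q ^+ 3) <= L * L / P ^+ 3.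
  rewrite ler_pdivrMr ?mulr_gt0 ?exprn_gt0//.
  have -> : L * L / P ^+ 3 * (P ^+ 2 * Q ^+ 3) = L * (L * Q * Q ^+ 2 / P).
    by field; rewrite gt_eqF.
  rewrite ler_peMr ?(ltW L0)// ler_pdivlMr// mul1r.
  by apply: le_trans PQ _; rewrite ler_peMr// ltW// mulr_gt0.
(* [Q^2] cancels against [Q^5], and the remaining [Q^3] is distributed to both summands to match
   [ha] and [hb]. *)
have -> : 2 ^+ (5 + n) / (Q ^+ 5 * Q ^+ n) * (L * Q ^+ 2) *
    (A * (L - 1) ^+ 2 * q / P ^+ 4 + C / P ^+ 2) =
  2 ^+ (5 + n) / Q ^+ n * (A * (L * (L - 1) ^+ 2 * q / (P ^+ 4 * Q ^+ 3))
    + C * (L / (P ^+ 2 * Q ^+ 3))).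
  have Qn : Q ^+ n != 0 by rewrite expf_neq0// gt_eqF.
  by move: (2 ^+ _) (Q ^+ n) Qn => t Qn Qn0; field; rewrite Qn0 !gt_eqF.
have -> : 2 ^+ (5 + n) * (A + C) * (L * L) * (P ^+ 3 * Q ^+ n)^-1 =
  2 ^+ (5 + n) / Q ^+ n * (A * (L * L / P ^+ 3) + C * (L * L / P ^+ 3)).
  have Qn : Q ^+ n != 0 by rewrite expf_neq0// gt_eqF.
  by move: (2 ^+ _) (Q ^+ n) Qn => t Qn Qn0; field; rewrite Qn0 !gt_eqF.
rewrite ler_wpM2l ?divr_ge0 ?exprn_ge0 ?(ltW Q0)//.
by rewrite lerD// ler_wpM2l.
Qed.

(* Because [(1 + l |s|)^2 <= 2 (1 + l^2 s^2)]. *)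
Lemma powR_le_kernel l s q : 0 <= l -> s ^+ 2 <= q ->
  (1 + l ^+ 2 * q) `^ (- (3 / 5)) <= 2 * kernel l s.
Proof.
move=> l0 sq; have q0 : 0 <= q := le_trans (sqr_ge0 s) sq.
have e0 : 0 < 1 + l * `|s| by rewrite ltr_pwDl// mulr_ge0.
have P0 : 0 < 1 + l ^+ 2 * q by rewrite ltr_pwDl// mulr_ge0// sqr_ge0.
have -> : kernel l s = ((1 + l * `|s|) ^+ 2) `^ (- (3 / 5)).
  by rewrite -powR_mulrn ?ltW// -powRrM /kernel; congr (_ `^ _); field.
rewrite !powRN -[leLHS]mul1r ler_pdivrMr ?powR_gt0// mulrAC.
rewrite ler_pdivlMr ?powR_gt0 ?exprn_gt0// mul1r.
apply: (@le_trans _ _ ((2 * (1 + l ^+ 2 * q)) `^ (3 / 5))).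
  apply: ge0_ler_powR => //;
    rewrite ?nnegrE ?exprn_ge0 ?mulr_ge0 ?(ltW e0) ?(ltW P0)//.
  have : l ^+ 2 * s ^+ 2 <= l ^+ 2 * q by rewrite ler_wpM2l// sqr_ge0.
  by rewrite -(real_normK (num_real s)); have := sqr_ge0 (1 - l * `|s|); nra.
rewrite powRM ?(ltW P0)// ler_wpM2r ?powR_ge0//.
rewrite -[leRHS]powRr1//; apply: ler_powR; first by rewrite ler1n.
by lra.
Qed.

(** The first five coordinates share the decay of [(1 + l^2 q)^-3]; the others share that of
    [(1 + q)^-n]. *)
Definition scale_at l i : R := if (i < 5)%N then l else 1.

(** [P^-3] is the fifth power of [P^(-3/5)], and [Q^-1 <= Q^(-3/5)] as [Q >= 1]. Each factor is then
    bounded by its own coordinate with [powR_le_kernel], at the cost of a 2. *)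
Lemma kernel_prod_ge n l q (s : 'I_(5 + n) -> R) : 0 < l -> 0 <= q ->
  (forall i, s i ^+ 2 <= q) ->
  ((1 + l ^+ 2 * q) ^+ 3 * (1 + q) ^+ n)^-1 <=
  2 ^+ (5 + n) * \prod_(i < 5 + n) kernel (scale_at l i) (s i).
Proof.
move=> l0 q0 sq.
have -> : 2 ^+ (5 + n) * \prod_(i < 5 + n) kernel (scale_at l i) (s i) =
    \prod_(i < 5 + n) (2 * kernel (scale_at l i) (s i)).
  by rewrite big_split/= prodr_const card_ord.
apply: (@le_trans _ _
    (\prod_(i < 5 + n) (1 + scale_at l i ^+ 2 * q) `^ (- (3 / 5)))); last first.
  apply: ler_prod => i _; rewrite powR_ge0 powR_le_kernel//.
  by rewrite /scale_at; case: ifP => _ //; exact: ltW.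
have P0 : 0 < 1 + l ^+ 2 * q by rewrite ltr_pwDl// mulr_ge0// sqr_ge0.
have Q1 : 1 <= 1 + q by rewrite lerDl.
have Q0 : 0 < 1 + q by exact: (lt_le_trans ltr01 Q1).
rewrite big_split_ord/= [X in _ <= X * _](_ : _ = ((1 + l ^+ 2 * q) ^+ 3)^-1).
  rewrite invfM ler_pM2l ?invr_gt0 ?exprn_gt0//.
  rewrite [X in _ <= X](_ : _ = ((1 + q) `^ (- (3 / 5))) ^+ n); last first.
    rewrite -[in RHS](card_ord n) -prodr_const; apply: eq_bigr => i _.
    by rewrite /scale_at /= expr1n mul1r.
  rewrite -exprVn; apply: lerXn2r;
    rewrite ?nnegrE ?powR_ge0 ?invr_ge0 ?(ltW Q0)//.
  rewrite powRN lef_pV2 ?posrE ?powR_gt0//.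
  by rewrite -[leRHS]powRr1 ?(ltW Q0)//; apply: ler_powR => //; lra.
rewrite (eq_bigr (fun=> (1 + l ^+ 2 * q) `^ (- (3 / 5)))); last first.
  by move=> i _; rewrite /scale_at /= ltn_ord.
rewrite prodr_const card_ord powRN exprVn; congr (_^-1).
rewrite -(powR_mulrn 3 (ltW P0)) -(powR_mulrn 5 (powR_ge0 _ _)) -powRrM.
by congr (_ `^ _); field.
Qed.

(** Here the dimension being at least 5 matters: five factors [1 / l] outweigh the [l^4] of
    [energy_profile_le]. *)
Lemma scale_at_prod n l : 0 < l ->
  \prod_(i < 5 + n) (10 / scale_at l i) = 10 ^+ (5 + n) / l ^+ 5.
Proof.
move=> l0; rewrite prodf_div prodr_const card_ord; congr (_ / _).
rewrite big_split_ord/= [X in _ * X]big1; last by move=> i _; rewrite /scale_at.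
rewrite mulr1 (eq_bigr (fun=> l)); last first.
  by move=> i _; rewrite /scale_at /= ltn_ord.
by rewrite prodr_const card_ord.
Qed.

Lemma E2c_dilation_le n l : 1 <= l ->
  (E2c (@dilation R (5 + n) l) <=
     (2^-1 * (energy_constant (5 + n) * 20 ^+ (5 + n) / l))%:E)%E.
Proof.
move=> l1; have l0 : 0 < l by exact: (lt_le_trans ltr01 l1).
rewrite /E2c [leRHS]EFinM; apply: lee_wpmul2l.
  by rewrite lee_fin invr_ge0.
rewrite /sphere_integral.
pose q (t : (5 + n).-tuple (measurableTypeR R)) : R :=
  \sum_(i < 5 + n) tnth t i ^+ 2.
have q0 t : 0 <= q t by apply: sumr_ge0 => i _; exact: sqr_ge0.
have qi t i : tnth t i ^+ 2 <= q t.
  rewrite /q (bigD1 i)//= lerDl; apply: sumr_ge0 => j _; exact: sqr_ge0.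
have K0 : 0 <= energy_constant (5 + n) by exact: energy_constant_ge0.
under eq_integral => t _.
  rewrite energy_profileE//.
  (* The redundant absolute value brings the integrand to the form of
     [continuous_energy_profile]. *)
  have -> : dotp (\row_i tnth t i) (\row_i tnth t i) = `|q t|.
    rewrite ger0_norm// dotpE; apply: eq_bigr => i _.
    by rewrite mxE expr2.
  over.
pose G i := kernel (scale_at l i).
have s0 i : 0 < scale_at l i by rewrite /scale_at; case: ifP.
have mG i : measurable_fun setT (G i).
  by apply: continuous_measurable_fun; exact/continuous_kernel/ltW.
have mprod : measurable_fun setT (fun t : (5 + n).-tuple (measurableTypeR R) =>
    \prod_(i < 5 + n) G i (tnth t i)).
  apply: measurable_prod => i _.
  exact: (measurableT_comp (mG i) (measurable_tnth i)).
have mq : measurable_fun setT q.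
  apply: measurable_sum => i.
  by apply: measurable_funX; exact: measurable_tnth.
pose K := energy_constant (5 + n) * l ^+ 4 * 2 ^+ (5 + n).
have Kl0 : 0 <= energy_constant (5 + n) * l ^+ 4.
  by apply: mulr_ge0 => //; apply: exprn_ge0; exact: ltW.
have K'0 : 0 <= K by apply: mulr_ge0 => //; exact: exprn_ge0.
apply: (@le_trans _ _ (\int[lebesgue_tuple R (5 + n)]_t
    (K%:E * (\prod_(i < 5 + n) G i (tnth t i))%:E))%E).
  apply: ge0_le_integral => //.
  - by move=> t _; rewrite lee_fin energy_profile_ge0.
  - apply/measurable_EFinP.
    have mf := continuous_measurable_fun (@continuous_energy_profile (5 + n) l).
    exact: (measurableT_comp mf mq).
  - by apply/measurable_EFinP; exact: measurable_funM.
  - move=> t _; rewrite ger0_norm// -EFinM lee_fin.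
    apply: le_trans (energy_profile_le n l1 (q0 t)) _.
    rewrite /K -[leRHS]mulrA ler_wpM2l//.
    exact: kernel_prod_ge.
rewrite ge0_integralZl_EFin//; last 2 first.
- by move=> t _; rewrite lee_fin prodr_ge0// => i _; exact: kernel_ge0.
- exact/measurable_EFinP.
rewrite (integral_lebesgue_tuple_prod _ (c := fun i => 10 / scale_at l i))//;
  last 2 first.
- by move=> i s; exact: kernel_ge0.
- by move=> i; exact: integral_kernel.
rewrite scale_at_prod// -EFinM lee_fin /K.
(* Each coordinate contributes 2 from [kernel_prod_ge] and 10 from [integral_kernel]. *)
rewrite (_ : 20 = 2 * 10 :> R) ?exprMn; last by rewrite -natrM.
move: (energy_constant _) (2 ^+ _) (10 ^+ _) => a b c.
by rewrite le_eqVlt; apply/orP; left; apply/eqP; field; rewrite gt_eqF.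
Qed.

End EnergyBound.

(** * Choice of the dilation parameter *)

Theorem theorem4p4 (R : realType) (m : nat) (hm : (5 <= m)%N)
    (eps : R) (heps : 0 < eps) :
  exists phi : 'rV[R]_m.+1 -> 'rV[R]_m.+1,
    [/\ set_fun (sphere R m) (sphere R m) phi,
        smooth_map (sphere R m) phi,
        homotopic R (sphere R m) (sphere R m) phi id &
        (E2c phi < eps%:E)%E].
Proof.
have [n ->] : exists n, m = (5 + n)%N by exists (m - 5)%N; rewrite subnKC.
pose C : R := energy_constant (5 + n) * 20 ^+ (5 + n).
have C0 : 0 <= C.
  by apply: mulr_ge0; [exact: energy_constant_ge0|exact: exprn_ge0].
have l1 : 1 <= 1 + C / eps by rewrite lerDl divr_ge0// ltW.
have l0 : 0 < 1 + C / eps by exact: (lt_le_trans ltr01 l1).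
(* For [l = 1 + C / eps] one has [l >= 1] and [eps l = eps + C > C / 2], so the bound [C / (2 l)] is
   below [eps]. *)
exists (dilation (1 + C / eps)); split.
- by move=> x; exact: dilation_sphere.
- exact: dilation_smooth.
- exact: dilation_homotopic.
apply: le_lt_trans (E2c_dilation_le _ l1) _; rewrite lte_fin -/C.
rewrite mulrA ltr_pdivrMr//.
have -> : eps * (1 + C / eps) = eps + C by field; rewrite gt_eqF.
by lra.
Qed.
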